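(* Let $n\ge 12$. Then there exists a $4$-uniform hypergraph $\mathcal{H}=(V,\mathcal{E})$ with $EI(\mathcal{H})=C_n$ and $|\mathcal{E}|=\lceil \frac{3}{4}n\rceil$. Consequently $\mu^4_n=\lceil\frac{3}{4}n\rceil$.
   Context: Hypergraphs $\mathcal{H}=(V,\mathcal{E})$ have no multiple hyperedges; isolated vertices are allowed. $\mathcal{H}$ is $k$-uniform if every hyperedge has exactly $k$ elements. The edge intersection hypergraph of $\mathcal{H}$ is $EI(\mathcal{H})=(V,\mathcal{E}^{EI})$ with $\mathcal{E}^{EI}=\{e_1\cap e_2: e_1,e_2\in\mathcal{E},\ e_1\ne e_2,\ |e_1\cap e_2|\ge 2\}$. $C_n$ is the cycle with vertex set $\{1,\dots,n\}$ and edges $\{i,i+1\}$, $i=1,\dots,n$ (indices mod $n$); ''$EI(\mathcal{H})=C_n$'' means $V=\{1,\dots,n\}$ and $\mathcal{E}^{EI}$ is exactly the edge set of $C_n$. $\mu^k_n$ is the minimum of $|\mathcal{E}|$ over all $k$-uniform $\mathcal{H}=(V,\mathcal{E})$ with $EI(\mathcal{H})=C_n$. *)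

(* Defs.v *)
From mathcomp Require Import all_boot.

Set Implicit Arguments.
Unset Strict Implicit.
Unset Printing Implicit Defensive.

(* A hypergraph on the vertex set V is its set of hyperedges: there are no
   multiple hyperedges, and vertices in no hyperedge are allowed. *)
Notation hypergraph V := {set {set V}}.

Definition uniform (V : finType) (k : nat) (H : hypergraph V) : bool :=
  [forall e in H, #|e| == k].

Definition EI (V : finType) (H : hypergraph V) : hypergraph V :=
  [set e1 :&: e2 | e1 in H, e2 in H & (e1 != e2) && (2 <= #|e1 :&: e2|)].

(* Vertices are numbered 0, ..., n-1 rather than 1, ..., n;
   ordS is the successor modulo n. *)
Definition cycle_graph (n : nat) : hypergraph 'I_n :=
  [set [set i; ordS i] | i : 'I_n].

Definition admissible (k n : nat) (H : hypergraph 'I_n) : bool :=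
  uniform k H && (EI H == cycle_graph n).

(* None when no k-uniform hypergraph H satisfies EI H = C_n, so that the
   minimum is over the empty set. *)
Definition mu (k n : nat) : option nat :=
  if [pick H | admissible k H] is Some H0
  then Some #|[arg min_(H < H0 | @admissible k n H) #|H|]|
  else None.

Lemma muP (k n m : nat) :
  mu k n = Some m <->
  (exists2 H : hypergraph 'I_n, admissible k H & #|H| = m) /\
  (forall H : hypergraph 'I_n, admissible k H -> m <= #|H|).
Proof.
rewrite /mu; case: pickP => [H0 adH0 | no]; last first.
  by split=> // -[[H]]; rewrite no.
case: arg_minnP => // H adH minH; split=> [[<-]|[[H' adH' <-] minH']].
  by split=> //; exists H.
by congr Some; apply/eqP; rewrite eqn_leq minH // minH'.
Qed.

Definition ceil_divn (m d : nat) : nat := (m + d.-1) %/ d.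

Lemma ceil_divn_leq (m d q : nat) : 0 < d ->
  (ceil_divn m d <= q) = (m <= q * d).
Proof.
case: d => // d _; rewrite /ceil_divn -ltnS ltn_divLR //=.
by rewrite mulSn addnC addSn ltnS leq_add2l.
Qed.

(* Main.v *)
(** Lower bound: the two pairs of hyperedges realising the cycle edges at a
    vertex are different pairs, so every vertex lies in at least three
    hyperedges, and double counting incidences gives [3 n <= 4 |E|].

    Construction: the paths {2j-1, 2j, 2j+1, 2j+2} realise the edges
    {2j+1, 2j+2}, and their middle edges {2j, 2j+1} are realised by blocks
    consisting of two middle edges far apart.  For odd n the edges {n-2, n-1}
    and {n-1, 0} are still missing; each lies on one path, and the further
    hyperedge {n-2, n-1, 0, 3} realises both. *)
Require Import Defs.
From mathcomp Require Import all_boot zify.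

Set Implicit Arguments.
Unset Strict Implicit.
Unset Printing Implicit Defensive.

(** * Vertex degrees and the lower bound *)

Lemma val_ordS n (i : 'I_n) : ordS i = (if i.+1 == n then 0 else i.+1) :> nat.
Proof.
case: eqP => [eq_n | ne_n] /=; first by rewrite eq_n modnn.
by rewrite modn_small //; have := ltn_ord i; lia.
Qed.

Lemma cycle_edges_neq n (i : 'I_n) :
  2 < n -> [set i; ordS i] != [set ord_pred i; i].
Proof.
move=> n_gt2; apply/eqP=> eq_e.
have := set22 i (ordS i); rewrite eq_e => /set2P[] /(congr1 (@nat_of_ord n)).
  have := val_ordS (ord_pred i); rewrite ord_predK val_ordS.
  move: (ltn_ord i) (ltn_ord (ord_pred i)); clear eq_e.
  by move: (nat_of_ord i) (nat_of_ord _) => x y; do !case: eqP; lia.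
by rewrite val_ordS; move: (ltn_ord i); clear eq_e; case: eqP; lia.
Qed.

Lemma EI_cycleP n (H : hypergraph 'I_n) (i : 'I_n) :
  EI H = cycle_graph n ->
  exists e1 e2, [/\ e1 \in H, e2 \in H, e1 != e2 & e1 :&: e2 = [set i; ordS i]].
Proof.
move=> EI_H; have: [set i; ordS i] \in EI H by rewrite EI_H; apply: imset_f.
case/imset2P=> e1 e2 He1; rewrite inE => /and3P[He2 ne _] eq_e.
by exists e1, e2.
Qed.

Lemma cycle_vertex_degree n (H : hypergraph 'I_n) (i : 'I_n) :
  2 < n -> EI H = cycle_graph n -> 2 < #|[set e in H | i \in e]|.
Proof.
move=> n_gt2 EI_H.
have [e1 [e2 [He1 He2 ne12 eq12]]] := EI_cycleP i EI_H.
have [e3 [e4 [He3 He4 ne34 eq34]]] := EI_cycleP (ord_pred i) EI_H.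
rewrite ord_predK in eq34.
have /setIP[ie1 ie2] : i \in e1 :&: e2 by rewrite eq12 set21.
have /setIP[ie3 ie4] : i \in e3 :&: e4 by rewrite eq34 set22.
rewrite ltnNge; apply/negP => le2.
(* With at most two hyperedges through [i], both pairs would be [e1, e2], so the two cycle edges at
   [i] would coincide. *)
have defS : [set e in H | i \in e] = [set e1; e2].
  apply/esym/eqP; rewrite eqEcard cards2 ne12 le2 andbT.
  by apply/subsetP=> e /set2P[]->; rewrite inE ?He1 ?He2.
have /set2P e3E : e3 \in [set e1; e2] by rewrite -defS inE He3.
have /set2P e4E : e4 \in [set e1; e2] by rewrite -defS inE He4.
case/eqP: (cycle_edges_neq i n_gt2); rewrite -eq12 -eq34.
by case: e3E e4E ne34 => -> [] ->; rewrite ?eqxx // setIC.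
Qed.

Lemma sum_card_degree (V : finType) (H : hypergraph V) :
  \sum_(e in H) #|e| = \sum_(i : V) #|[set e in H | i \in e]|.
Proof.
under eq_bigr do rewrite -sum1_card.
rewrite (exchange_big_dep predT) //=; apply: eq_bigr => i _.
by rewrite -sum1_card; apply: eq_bigl => e; rewrite inE.
Qed.

Lemma cycle_size_lower_bound k n (H : hypergraph 'I_n) :
  2 < n -> uniform k H -> EI H = cycle_graph n -> 3 * n <= #|H| * k.
Proof.
move=> n_gt2 /forall_inP unif EI_H.
rewrite -sum_nat_const -(eq_bigr _ (fun e He => eqP (unif e He))).
rewrite sum_card_degree -{1}(card_ord n) mulnC -sum_nat_const.
by apply: leq_sum => i _; apply: cycle_vertex_degree.
Qed.

(** * Families of vertex sets whose intersections are cliques of the cycle *)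

Definition vset n (s : seq nat) : {set 'I_n} := [set x : 'I_n | val x \in s].

Lemma card_vset n (s : seq nat) :
  uniq s -> all (ltn^~ n) s -> #|vset n s| = size s.
Proof.
move=> Us /allP lt_s; rewrite cardE -(size_map val).
apply/perm_size/uniq_perm => // [|x].
  by rewrite map_inj_uniq ?enum_uniq //; apply: val_inj.
apply/mapP/idP => [[y] | x_s]; first by rewrite mem_enum inE => ? ->.
by exists (Ordinal (lt_s x x_s)); rewrite ?mem_enum ?inE.
Qed.

Definition cyc_adjacent n (x y : 'I_n) : bool := (y == ordS x) || (x == ordS y).

(** Adjacency on naturals with the modulus spelled out, so that linear arithmetic decides it. *)
Definition cyc_near n x y : bool :=
  [|| y == x.+1, x == y.+1, (x == 0) && (y.+1 == n) | (y == 0) && (x.+1 == n)].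

Lemma cyc_adjacentE n (x y : 'I_n) :
  2 < n -> cyc_adjacent x y = cyc_near n x y.
Proof.
move=> n_gt2; rewrite /cyc_near /cyc_adjacent -!(inj_eq val_inj).
have := val_ordS x; have := val_ordS y => /= -> ->.
by have := ltn_ord x; have := ltn_ord y; do !case: ifP; lia.
Qed.

Definition cyc_clique n (S : {set 'I_n}) : Prop :=
  {in S &, forall x y, x != y -> cyc_adjacent x y}.

(** A cycle on at least four vertices has no triangle. *)
Lemma cyc_clique_edge n (S : {set 'I_n}) (i : 'I_n) : 3 < n ->
  cyc_clique S -> i \in S -> ordS i \in S -> S = [set i; ordS i].
Proof.
move=> n_gt3 clS iS i1S; apply/eqP; rewrite eqEsubset subUset !sub1set iS i1S.
rewrite !andbT; apply/subsetP=> z zS; apply/set2P.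
have [|ne_zi] := eqVneq z i; first by left.
have [|ne_zi1] := eqVneq z (ordS i); first by right.
have := clS _ _ zS iS ne_zi; have := clS _ _ zS i1S ne_zi1.
rewrite !cyc_adjacentE ?(ltnW n_gt3) // /cyc_near.
have := val_ordS i; move: ne_zi ne_zi1; rewrite -!(inj_eq val_inj) /= => + + ->.
by have := ltn_ord i; have := ltn_ord z; case: ifP; lia.
Qed.

(** Two points of a clique span a cycle edge, which is then the whole clique; so large intersections
    are edges, and covering makes every edge occur. *)
Lemma EI_family n (I : finType) (F : I -> {set 'I_n}) : 3 < n ->
  (forall a, 2 < #|F a|) ->
  (forall a b, a != b -> cyc_clique (F a :&: F b)) ->
  (forall i, exists a b, [/\ a != b, i \in F a :&: F b & ordS i \in F a :&: F b]) ->
  EI [set F a | a : I] = cycle_graph n.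
Proof.
move=> n_gt3 F_gt2 F_cl F_cov; apply/setP=> e; apply/imset2P/imsetP.
  case=> e1 e2 /imsetP[a _ def1].
  rewrite inE => /and3P[/imsetP[b _ def2] neF + ->].
  rewrite {}def1 {}def2 in neF *.
  have ne_ab : a != b by apply: contraNneq neF => ->.
  case/card_gt1P=> x [y [xS yS ne_xy]].
  have cl := F_cl _ _ ne_ab.
  have /orP[/eqP y1 | /eqP x1] := cl _ _ xS yS ne_xy.
    by exists x => //; apply: cyc_clique_edge => //; rewrite -y1.
  by exists y => //; apply: cyc_clique_edge => //; rewrite -x1.
case=> i _ ->; have [a [b [ne_ab iS i1S]]] := F_cov i.
have eq_e := cyc_clique_edge n_gt3 (F_cl _ _ ne_ab) iS i1S.
have card_e : #|[set i; ordS i]| = 2.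
  rewrite cards2 -(inj_eq val_inj) /=; have := val_ordS i => /= ->.
  by have := ltn_ord i; case: ifP; lia.
have in_F c : F c \in [set F a | a : I] by apply: imset_f.
exists (F a) (F b) => //; rewrite inE in_F eq_e card_e andbT /=.
(* If [F a = F b], this set would be its own intersection, hence an edge with only two elements. *)
apply/eqP=> eqF; have := F_gt2 b.
by move: eq_e; rewrite eqF setIid => ->; rewrite card_e.
Qed.

(** * The hyperedges of the construction *)

Definition path_seq n j : seq nat :=
  [:: if j is 0 then n.-1 else j.*2.-1; j.*2; j.*2.+1;
      if j.*2.+2 == n then 0 else j.*2.+2].

(** Used with [h = n./2./2] and [j < uphalf n./2]: then [j] and [j + h] run through all [n./2]
    middle edges. *)
Definition block_seq h j : seq nat :=
  [:: j.*2; j.*2.+1; (j + h).*2; (j + h).*2.+1].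

(** The vertex 3 is the first one outside path 0; with 1 or 2 instead, the intersection with that
    path would exceed [{n-1, 0}]. *)
Definition closing_seq n : seq nat := [:: n.-2; n.-1; 0; 3].

(** The boolean [odd n] is read as 0 or 1: a closing index exists exactly for odd [n]. *)
Definition hyperedge_index n : finType :=
  ('I_n./2 + 'I_(uphalf n./2) + 'I_(odd n))%type.

Definition hyperedge_seq n (a : hyperedge_index n) : seq nat :=
  match a with
  | inl (inl j) => path_seq n j
  | inl (inr j) => block_seq n./2./2 j
  | inr _ => closing_seq n
  end.

(** The bounds are shifted by one to avoid the truncated [2j-1] at [j = 0]; the other disjuncts are
    the wrap-arounds. *)
Lemma mem_path_seq n j x : 12 <= n -> j < n./2 -> x < n ->
  (x \in path_seq n j) =
    [|| j.*2 <= x.+1 <= j.*2.+3, (j == 0) && (x.+1 == n)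
      | (j.*2.+2 == n) && (x == 0)].
Proof.
move=> n_ge12 lt_j lt_x; rewrite !inE.
by case: j lt_j => [|j] lt_j; case: (_ =P n); lia.
Qed.

Lemma card_hyperedge n (a : hyperedge_index n) :
  12 <= n -> #|vset n (hyperedge_seq a)| = 4.
Proof.
move=> n_ge12; rewrite card_vset; case: a => [[[j lt_j]|[j lt_j]]|c] //=.
- by rewrite !inE; case: j lt_j => [|j] lt_j; case: (_ =P n); lia.
- by rewrite !inE; lia.
- by rewrite !inE; lia.
- by case: j lt_j => [|j] lt_j; case: (_ =P n); lia.
- by lia.
- by lia.
Qed.

(** * Pairwise intersections of the hyperedges *)

Definition meet_in_edge n (s t : seq nat) : Prop :=
  forall x y, x < n -> y < n -> x \in s -> x \in t -> y \in s -> y \in t ->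
  x != y -> cyc_near n x y.

Lemma mem_block_seq h j x :
  (x \in block_seq h j) = (x./2 == j) || (x./2 == j + h).
Proof. by rewrite !inE; lia. Qed.

Lemma path_path_meet n i j : 12 <= n -> i < n./2 -> j < n./2 -> i != j ->
  meet_in_edge n (path_seq n i) (path_seq n j).
Proof.
move=> n_ge12 lt_i lt_j ne_ij x y lt_x lt_y.
rewrite !mem_path_seq // /cyc_near.
by lia.
Qed.

(** Path [i] touches at most the middle edges [i-1], [i], [i+1], cyclically. Those of a block are at
    cyclic distance at least 3, since [n./2 >= 6], so the path meets only one of them. *)
Lemma path_block_meet n i j : 12 <= n -> i < n./2 -> j < uphalf n./2 ->
  meet_in_edge n (path_seq n i) (block_seq n./2./2 j).
Proof.
move=> n_ge12 lt_i lt_j x y lt_x lt_y.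
rewrite !mem_path_seq // !mem_block_seq /cyc_near.
by lia.
Qed.

(** Distinct blocks are disjoint, except that for odd [n./2] blocks 0 and [n./2./2] share one middle
    edge. *)
Lemma block_block_meet n i j : 12 <= n ->
  i < uphalf n./2 -> j < uphalf n./2 -> i != j ->
  meet_in_edge n (block_seq n./2./2 i) (block_seq n./2./2 j).
Proof.
move=> n_ge12 lt_i lt_j ne_ij x y lt_x lt_y.
rewrite !mem_block_seq /cyc_near.
by lia.
Qed.

Lemma path_closing_meet n i : 12 <= n -> odd n -> i < n./2 ->
  meet_in_edge n (path_seq n i) (closing_seq n).
Proof.
move=> n_ge12 odd_n lt_i x y lt_x lt_y.
rewrite !mem_path_seq // !inE /cyc_near.
by lia.
Qed.

(** The vertices [n-2], 0 and 3 lie in three different blocks and [n-1] in none. *)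
Lemma block_closing_meet n i : 12 <= n -> odd n -> i < uphalf n./2 ->
  meet_in_edge n (block_seq n./2./2 i) (closing_seq n).
Proof.
move=> n_ge12 odd_n lt_i x y lt_x lt_y.
rewrite !mem_block_seq !inE /cyc_near.
by lia.
Qed.

Lemma meet_in_edge_sym n s t : meet_in_edge n s t -> meet_in_edge n t s.
Proof. by move=> st x y lt_x lt_y xt xs yt ys; apply: st. Qed.

Lemma hyperedge_meet n (a b : hyperedge_index n) : 12 <= n -> a != b ->
  meet_in_edge n (hyperedge_seq a) (hyperedge_seq b).
Proof.
move=> n_ge12.
have odd_closing (c : 'I_(odd n)) : odd n by case: c; case: (odd n).
case: a b => [[i|i]|c] [[j|j]|d] ne_ab /=.
- exact: path_path_meet.
- exact: path_block_meet.
- by apply: path_closing_meet => //; apply: odd_closing d.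
- exact/meet_in_edge_sym/path_block_meet.
- exact: block_block_meet.
- by apply: block_closing_meet => //; apply: odd_closing d.
- by apply/meet_in_edge_sym/path_closing_meet => //; apply: odd_closing c.
- by apply/meet_in_edge_sym/block_closing_meet => //; apply: odd_closing c.
case/eqP: ne_ab; congr inr; apply: ord_inj.
by move: (ltn_ord c) (ltn_ord d) (leq_b1 (odd n)); lia.
Qed.

Lemma hyperedge_clique n (a b : hyperedge_index n) : 12 <= n -> a != b ->
  cyc_clique (vset n (hyperedge_seq a) :&: vset n (hyperedge_seq b)).
Proof.
move=> n_ge12 ne_ab x y; rewrite !in_setI ![_ \in vset _ _]inE.
case/andP=> xa xb /andP[ya yb] ne_xy; rewrite cyc_adjacentE; last by lia.
exact: (hyperedge_meet n_ge12 ne_ab).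
Qed.

(** * Realising every cycle edge, and the count *)

Lemma hyperedge_cover n (i : 'I_n) : 12 <= n ->
  exists a b : hyperedge_index n,
    [/\ a != b, i \in vset n (hyperedge_seq a) :&: vset n (hyperedge_seq b)
      & ordS i \in vset n (hyperedge_seq a) :&: vset n (hyperedge_seq b)].
Proof.
move=> n_ge12; have lt_i := ltn_ord i.
move: (ordS i) (val_ordS i) => i1 val_i1; have lt_i1 := ltn_ord i1.
pose P j (lt_j : j < n./2) : hyperedge_index n := inl (inl (Ordinal lt_j)).
pose Q j (lt_j : j < uphalf n./2) : hyperedge_index n := inl (inr (Ordinal lt_j)).
have lt_0 : 0 < n./2 by lia.
have [odd_i | even_i] := boolP (odd i); last first.
  have [last_i | not_last] := eqVneq i.+1 n.
    have lt_c : 0 < odd n by lia.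
    exists (P 0 lt_0), (inr (Ordinal lt_c)); split=> //=;
      rewrite in_setI /vset !in_set /= mem_path_seq // !inE ?val_i1 ?last_i ?eqxx //; lia.
  have lt_j : i./2 < n./2 by lia.
  (* Middle edge [i./2] is the first half of block [i./2] if that block exists, and otherwise the
     second half of block [k]. *)
  pose k := if i./2 < uphalf n./2 then i./2 else i./2 - n./2./2.
  have lt_k : k < uphalf n./2 by rewrite /k; case: ifP; lia.
  exists (P _ lt_j), (Q _ lt_k); split=> //=;
    rewrite in_setI /vset !in_set /= mem_path_seq // mem_block_seq /k ?val_i1 ?(negPf not_last);
    case: ifP; lia.
have lt_j : i./2 < n./2 by lia.
have [lt_j1 | ge_j1] := ltnP i./2.+1 n./2.
  exists (P _ lt_j), (P _ lt_j1); split=> //=.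
  - by apply/eqP=> -[]; lia.
  - by rewrite in_setI /vset !in_set /= !mem_path_seq //; lia.
  - by rewrite in_setI /vset !in_set /= !mem_path_seq // val_i1; case: ifP; lia.
(* Here [i] is the last odd vertex: for even [n] the last path meets path 0 in the edge, for odd [n]
   it meets the closing hyperedge. *)
have [last_i | not_last] := eqVneq i.+1 n.
  exists (P _ lt_j), (P _ lt_0); split=> //=.
  - by apply/eqP=> -[]; lia.
  - by rewrite in_setI /vset !in_set /= !mem_path_seq //; lia.
  - by rewrite in_setI /vset !in_set /= !mem_path_seq // val_i1 last_i eqxx; lia.
have lt_c : 0 < odd n by lia.
exists (P _ lt_j), (inr (Ordinal lt_c)); split=> //=.
- by rewrite in_setI /vset !in_set /= !mem_path_seq // !inE; lia.
- by rewrite in_setI /vset !in_set /= !mem_path_seq // !inE val_i1 (negPf not_last); lia.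
Qed.

Theorem theorem6 (n : nat) (hn : 12 <= n) :
  (exists H : hypergraph 'I_n,
     [/\ uniform 4 H, EI H = cycle_graph n & #|H| = ceil_divn (3 * n) 4]) /\
  mu 4 n = Some (ceil_divn (3 * n) 4).
Proof.
have n_gt2 : 2 < n by apply: leq_trans hn.
have lower (H : hypergraph 'I_n) :
    admissible 4 H -> ceil_divn (3 * n) 4 <= #|H|.
  by case/andP=> unif /eqP EI_H; rewrite ceil_divn_leq // cycle_size_lower_bound.
pose H := [set vset n (hyperedge_seq a) | a : hyperedge_index n].
have unif : uniform 4 H.
  by apply/forall_inP=> _ /imsetP[a _ ->]; rewrite card_hyperedge.
have EI_H : EI H = cycle_graph n.
  apply: EI_family => [|a|a b|i]; first exact: leq_trans hn.
  - by rewrite card_hyperedge.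
  - exact: hyperedge_clique.
  - exact: hyperedge_cover.
have admH : admissible 4 H by rewrite /admissible unif EI_H eqxx.
have card_H : #|H| = ceil_divn (3 * n) 4.
  (* The lower bound excludes coinciding hyperedges, so counting indices suffices:
     [n./2 + uphalf n./2 + odd n] equals the ceiling. *)
  apply/eqP; rewrite eqn_leq lower // andbT.
  apply: leq_trans (leq_imset_card _ _) _.
  by rewrite !card_sum !card_ord /ceil_divn; lia.
split; first by exists H.
by apply/muP; split; [exists H | exact: lower].
Qed.
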